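(* Assume that $\psi=\psi(\lambda,t):\Lambda\times\mathcal{I}\to\mathbb{R}$ is a function of class $C^q$ ($q=1,2,\dots,\infty$), where $\mathcal{I}$ is an open interval of $\mathbb{R}$ with $0\in\mathcal{I}$, and that $\psi(\lambda,0)>0$. Fix a real number $r$ with $r\neq-1$. Then the function $F:\mathcal{I}\to\mathbb{R}$ defined by $$F:t\mapsto F(\lambda,t)=\epsilon(t)\left|\int_0^t|x|^r\,\psi(\lambda,x)\,dx\right|^{\frac{1}{r+1}}$$ is a $C^q$ differentiable function, and if $q\geq1$, then $F'(0)>0$.
   Context: $\Lambda$ is an open set of parameters $\lambda=(\lambda_1,\dots,\lambda_n)$ in $\mathbb{R}^n$. $\epsilon(t)=1$ if $t>0$, $\epsilon(0)=0$, $\epsilon(t)=-1$ if $t<0$. The prime denotes the derivative with respect to $t$, so $F'(0)$ means $\frac{\partial F}{\partial t}(\lambda,0)$.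
   Formalization: For r<-1 the integral diverges, so F is treated only for r>-1 (convergence iff r>-1 is proved); F is claimed C^q not on all of I but on the open set where t=0 or the integral is nonzero, since it can fail elsewhere (r=0, ψ=1-t, t=2). *)

(* Defs.v *)
From HB Require Import structures.
From mathcomp Require Import all_boot all_order all_algebra.
From mathcomp Require Import all_classical all_reals all_analysis.

Set Implicit Arguments.
Unset Strict Implicit.
Unset Printing Implicit Defensive.

Import Order.TTheory GRing.Theory Num.Theory.
Import numFieldNormedType.Exports.

Local Open Scope classical_set_scope.
Local Open Scope ring_scope.

Definition coord_dir (R : realType) (n : nat) (v : 'rV[R]_n * R) : Prop :=
  (exists i : 'I_n, v = (delta_mx 0 i, 0)) \/ v = (0, 1).

(* Continuity and derivability at a point of U only see the germ of f there,
   so, for U open, the values of f outside U do not matter. *)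
Fixpoint Ck (R : realType) (n k : nat) (U : set ('rV[R]_n * R))
    (f : 'rV[R]_n * R -> R) : Prop :=
  (forall p, U p -> {for p, continuous f}) /\
  match k with
  | 0%N => True
  | k'.+1 => forall v, coord_dir v ->
      (forall p, U p -> derivable f p v) /\ Ck k' U (fun p => 'D_v f p)
  end.

(* [None] encodes the order of differentiability infinity. *)
Definition Cq (R : realType) (n : nat) (q : option nat)
    (U : set ('rV[R]_n * R)) (f : 'rV[R]_n * R -> R) : Prop :=
  match q with
  | Some k => Ck k U f
  | None => forall k, Ck k U f
  end.

Section PowerIntegral.
Variables (R : realType) (r : R).
Implicit Types (g : R -> R) (t x : R).

(* The value at x = 0 is irrelevant for integration. *)
Definition weighted g x : R := `|x| `^ r * g x.

Definition converges g t : Prop :=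
  (@lebesgue_measure R).-integrable
    `[Num.min 0 t, Num.max 0 t] (EFin \o weighted g).

(* Oriented integral from 0 to t. *)
Definition power_integral g t : R :=
  if 0 <= t then \int[@lebesgue_measure R]_(x in `[0, t]) weighted g x
  else - \int[@lebesgue_measure R]_(x in `[t, 0]) weighted g x.

Definition root_integral g t : R :=
  Num.sg t * `|power_integral g t| `^ (r + 1)^-1.

(* If psi changes sign away from t = 0, the integral may vanish at some t <> 0;
   there the power |.|^(1/(r+1)) need not be differentiable (for r = 0 and
   psi(t) = 1 - t the function is |t - t^2/2| near t = 2). Such points are
   left out; when psi > 0 there are none. *)
Definition regular_dom (n : nat) (Lam : set 'rV[R]_n) (I : set R)
    (psi : 'rV[R]_n -> R -> R) : set ('rV[R]_n * R) :=
  [set p | [/\ Lam p.1, I p.2 &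
            p.2 = 0 \/ power_integral (psi p.1) p.2 <> 0]].

End PowerIntegral.

(* Main.v *)
Require Import Defs.
From HB Require Import structures.
From mathcomp Require Import all_boot all_order all_algebra.
From mathcomp Require Import all_classical all_reals all_analysis.
From mathcomp Require Import measurable_realfun ring lra.

(** On a slice, the substitution [x = t s] turns the integral from 0 to t of
    [|x|^r psi(lam, x)] into [t |t|^r G(lam, t)], where
    [G(lam, t) = \int_0^1 s^r psi(lam, t s) ds]. Hence
    [F(lam, t) = t |G(lam, t)|^(1/(r+1))]: the singular weight no longer meets
    the parameter t. [G] is C^q by differentiation under the integral sign,
    [G(lam, 0) = psi(lam, 0) \int_0^1 s^r ds > 0], and away from the zeros of [G]
    the power is smooth. The derivative of F at 0 is [G(lam, 0)^(1/(r+1))]. *)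

Set Implicit Arguments.
Unset Strict Implicit.
Unset Printing Implicit Defensive.

Import Order.TTheory GRing.Theory Num.Theory.
Import numFieldNormedType.Exports.
Local Open Scope classical_set_scope.
Local Open Scope ring_scope.

(** * Calculus of C^k functions *)

(** A derivative in t of the integrand on [0,1] brings down a factor s, so integrals with the fixed
    weight s^r are not closed under differentiation. Integrals of [w s * phi (lam, s t)] with an
    arbitrary integrable weight [w] are, and the induction on the order runs over this whole family.
    Limits pass under the integral because compactness of [0,1] makes the second factor converge
    uniformly in s. Since psi is positive only at t = 0, G may vanish elsewhere; the points of the
    domain where it does not are exactly those of [regular_dom]. For r <= -1 the weight s^r
    dominates 1/s on ]0,1] while psi stays above a positive constant near 0, so the integral
    diverges for every t <> 0; this confines the regularity statement to r > -1. *)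

Section Ck_calculus.
Context {R : realType} {n : nat}.
Local Notation E := ('rV[R]_n * R)%type.
Implicit Types (U V : set E) (f g : E -> R) (k : nat) (v p : E).

Lemma Ck_continuous k U f p : Ck k U f -> U p -> {for p, continuous f}.
Proof. by case: k => [|k] [fc _]; exact: fc. Qed.

Lemma Ck_sub k U V f : U `<=` V -> Ck k V f -> Ck k U f.
Proof.
move=> UV; elim: k f => [|k IH] f [fc fd]; split => [p /UV/fc//|] //.
move=> v /fd[dv /IH Dk]; split=> // p /UV; exact: dv.
Qed.

Lemma Ck_le1 k U f : Ck k.+1 U f -> Ck k U f.
Proof.
elim: k f => [|k IH] f [fc fd]; split => // v /fd[dv Dk]; split=> //.
exact: IH.
Qed.

(** As [U] is open, agreement on [U] is agreement of germs, so the directional derivatives agree on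
    [U] as well and the induction goes on. Later lemmas use this to trade a derivative for its
    closed formula. *)
Lemma Ck_eq k U f g : open U -> {in U, f =1 g} -> Ck k U f -> Ck k U g.
Proof.
move=> oU; elim: k f g => [|k IH] f g fg [fc fd].
  split=> // p Up; have fgp : {near p, f =1 g}.
    by apply: filterS (open_nbhs_nbhs (conj oU Up)) => q Uq; apply: fg; rewrite inE.
  rewrite /prop_for /continuous_at -(nbhs_singleton fgp).
  exact: cvg_trans (near_eq_cvg fgp) (fc p Up).
have near_fg p : U p -> {near p, f =1 g}.
  move=> Up; apply: filterS (open_nbhs_nbhs (conj oU Up)) => q Uq.
  by apply: fg; rewrite inE.
split.
  move=> p Up; rewrite /prop_for /continuous_at -(nbhs_singleton (near_fg p Up)).
  exact: cvg_trans (near_eq_cvg (near_fg p Up)) (fc p Up).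
move=> v cv; have [dv Dk] := fd v cv; split.
  by move=> p Up; apply: near_eq_derivable (dv p Up); exact: near_fg.
apply: IH Dk => p; rewrite inE => Up; apply: near_eq_derive; exact: near_fg.
Qed.

Lemma Ck_cst k U (a : R) : Ck k U (fun=> a).
Proof.
elim: k a => [|k IH] a; first by split=> // p _; exact: cvg_cst.
split=> [p _|v cv]; first exact: cvg_cst.
split; first by move=> p _; exact: derivable_cst.
rewrite (_ : (fun p => 'D_v (fun=> a) p) = (fun=> 0)); first exact: IH.
by apply/funext => p; exact: derive_cst.
Qed.

Lemma CkD k U f g : open U -> Ck k U f -> Ck k U g -> Ck k U (f \+ g).
Proof.
move=> oU; elim: k f g => [|k IH] f g [fc fd] [gc gd].
  by split=> // p Up; apply: cvgD; [exact: fc|exact: gc].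
split; first by move=> p Up; apply: cvgD; [exact: fc|exact: gc].
move=> v cv; have [df Df] := fd v cv; have [dg Dg] := gd v cv; split.
  by move=> p Up; apply: derivableD; [exact: df|exact: dg].
apply: Ck_eq (IH _ _ Df Dg) => // p; rewrite inE => Up /=.
by rewrite -deriveD; [|exact: df|exact: dg].
Qed.

Lemma CkM k U f g : open U -> Ck k U f -> Ck k U g -> Ck k U (f \* g).
Proof.
move=> oU; elim: k f g => [|k IH] f g Cf Cg; have [fc fd] := Cf; have [gc gd] := Cg.
  by split=> // p Up; apply: cvgM; [exact: fc|exact: gc].
split; first by move=> p Up; apply: cvgM; [exact: fc|exact: gc].
move=> v cv; have [df Df] := fd v cv; have [dg Dg] := gd v cv; split.
  by move=> p Up; apply: derivableM; [exact: df|exact: dg].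
have := CkD oU (IH _ _ (Ck_le1 Cf) Dg) (IH _ _ (Ck_le1 Cg) Df).
apply: Ck_eq => // p; rewrite inE => Up /=.
exact/esym/(deriveM (df p Up) (dg p Up)).
Qed.

Lemma is_derive_snd v p : is_derive p v (snd : E -> R) v.2.
Proof.
have cv : h^-1 *: (((snd : E -> R) \o shift p) (h *: v) - p.2) @[h --> 0^'] --> v.2.
  apply: cvg_near_cst; near=> h => /=.
  by rewrite addrK scalerA mulVf ?scale1r//; near: h; exact: nbhs_dnbhs_neq.
by split; [apply/cvg_ex; exists v.2|exact: cvg_lim].
Unshelve. all: by end_near. Qed.

Lemma Ck_snd k U : Ck k U snd.
Proof.
case: k => [|k]; first by split=> // p _; exact: cvg_snd.
split=> [p _|v _]; first exact: cvg_snd.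
have dsnd p := is_derive_snd v p.
split; first by move=> p _; apply: ex_derive.
rewrite (_ : (fun p => 'D_v snd p) = (fun=> v.2)); first exact: Ck_cst.
by apply/funext => p; rewrite derive_val.
Qed.

(** Only the derivative of [f] along [v] is available, not its differential, so [f] is restricted to
    the line through [p] and the one-variable chain rule is applied there. *)
Lemma is_derive_comp (h : R -> R) f v p (dh df : R) :
  is_derive (f p) 1 h dh -> is_derive p v f df -> is_derive p v (h \o f) (dh * df).
Proof.
move=> hd [fd fE].
pose fl u := f (u *: v + p).
have fl0 : fl 0 = f p by rewrite /fl scale0r add0r.
have dlE (F : E -> R) : (fun u : R => u^-1 *: ((F \o shift p) (u *: v) - F p)) =
    (fun u : R => u^-1 *: (((fun s : R => F (s *: v + p)) \o shift 0) (u *: 1) -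
        F (0 *: v + p))).
  by apply/funext => u; rewrite /= scale0r add0r addr0 [_%:A]mulr1.
have fld : is_derive (0 : R) 1 fl df.
  by split; [apply/(derivable1P f p v).1|rewrite -fE /derive [in RHS]dlE].
have hd' : is_derive (fl 0) 1 h dh by rewrite fl0.
have [cd cE] := is_derive1_comp hd' fld.
by split; [apply/(derivable1P (h \o f) p v).2|rewrite -cE /derive [in LHS]dlE].
Qed.

(** The sign of x is hidden in the factor x, with exponent a - 2 instead of a - 1: the derivative is
    then again x times a power of |x|, a form that can be differentiated repeatedly. *)
Lemma is_derive_powR_norm (a x : R) : x != 0 ->
  is_derive x 1 (fun y => `|y| `^ a) (a * (x * `|x| `^ (a - 2))).
Proof.
move=> x0; pose s := Num.sg x.
have s2 : s * s = 1 by rewrite -expr2 sqr_sg x0.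
have sx : s * x = `|x| by rewrite -normrEsg.
have : is_derive x 1 ((fun y : R => y `^ a) \o ( *%R s)) ((a * `|x| `^ (a - 1)) * s).
  apply: is_derive1_comp; last first.
    have := @is_deriveZ _ _ _ id s x 1 1 (is_derive_id x 1).
    by rewrite [_ *: _]mulr1.
  by rewrite sx; apply: is_derive1_powR; rewrite normr_gt0.
rewrite (_ : a * `|x| `^ (a - 1) * s = a * (x * `|x| `^ (a - 2))); last first.
  rewrite -mulrA; congr (_ * _).
  have -> : a - 1 = 1 + (a - 2) by ring.
  rewrite (@powRD _ _ 1 (a - 2)); last by rewrite normr_eq0 x0 implybT.
  rewrite powRr1 //; move: (_ `^ (a - 2)) => A; rewrite -sx.
  by rewrite -mulrA [A * s]mulrC mulrACA s2 mul1r.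
apply: near_eq_is_derive.
(* The sign is constant near a nonzero point, so |y| coincides there with the linear map s y. *)
have : \forall y \near x, Num.sg y = s.
  have [x_lt0|x_gt0|/eqP] := ltgtP x 0; last by rewrite (negPf x0).
    near=> y; rewrite /s (ltr0_sg x_lt0) ltr0_sg//.
    by near: y; exact: lt_nbhsl.
  near=> y; rewrite /s (gtr0_sg x_gt0) gtr0_sg//.
  by near: y; exact: lt_nbhsr.
by apply: filterS => y /= <-; rewrite -normrEsg.
Unshelve. all: by end_near. Qed.

(** The induction keeps [a] general, because each derivative lowers the exponent by 2. *)
Lemma Ck_powR_norm k U f (a : R) : open U -> (forall p, U p -> f p != 0) ->
  Ck k U f -> Ck k U (fun p => `|f p| `^ a).
Proof.
move=> oU f0; elim: k f a f0 => [|k IH] f a f0 Cf; have [fc fd] := Cf.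
  split=> // p Up.
  apply: (@continuous_comp _ _ _ f (fun y => `|y| `^ a)); first exact: fc.
  apply: differentiable_continuous; apply/derivable1_diffP.
  by have [] := is_derive_powR_norm a (f0 p Up).
split=> [p Up|v cv].
  apply: (@continuous_comp _ _ _ f (fun y => `|y| `^ a)); first exact: fc.
  apply: differentiable_continuous; apply/derivable1_diffP.
  by have [] := is_derive_powR_norm a (f0 p Up).
have [df Df] := fd v cv.
have D p : U p -> is_derive p v (fun p => `|f p| `^ a)
    (a * (f p * `|f p| `^ (a - 2)) * 'D_v f p).
  move=> Up; apply: (@is_derive_comp (fun y => `|y| `^ a) f); first exact/is_derive_powR_norm/f0.
  exact/derivableP/df.
split=> [p Up|]; first by have [] := D p Up.
have Cf' := Ck_le1 Cf.
have := CkM oU (CkM oU (Ck_cst k U a) (CkM oU Cf' (IH f (a - 2) f0 Cf'))) Df.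
apply: Ck_eq => // p; rewrite inE => Up /=.
by have [_ ->] := D p Up.
Qed.

End Ck_calculus.

(** * Integrals depending on a parameter *)

Section weighted_integral.
Context {R : realType}.
Local Notation mu := (@lebesgue_measure R).
Local Notation K := (`[0%R, 1%R]%classic : set R).
Implicit Types (w f g : R -> R).

Lemma integrable_weightM w f : mu.-integrable K (EFin \o w) ->
  {within K, continuous f} -> mu.-integrable K (EFin \o (fun s => w s * f s)).
Proof.
move=> iw cf.
rewrite (_ : EFin \o _ = ((EFin \o f) \* (EFin \o w))%E); last first.
  by apply/funext => s /=; rewrite mulrC EFinM.
apply: integrableMr => //.
  exact: subspace_continuous_measurable_fun.
have /compact_bounded[M [Mr MP]] := continuous_compact cf (@segment_compact R 0 1).
by exists M; split=> // x Mx y Ky; apply: MP => //; exists y.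
Qed.

(** The error is at most the uniform distance of the second factors times the integral of |w|. The
    filter is arbitrary so that the lemma serves both for continuity (points near p) and for
    difference quotients (h tending to 0, h <> 0). *)
Lemma cvg_weighted_integral {T : Type} (F : set_system T) {FF : Filter F}
    (g_ : T -> R -> R) w g : mu.-integrable K (EFin \o w) ->
  (forall e, 0 < e -> \forall h \near F, forall s, K s -> `|g_ h s - g s| <= e) ->
  (\forall h \near F, mu.-integrable K (EFin \o (fun s => w s * g_ h s))) ->
  mu.-integrable K (EFin \o (fun s => w s * g s)) ->
  \int[mu]_(s in K) (w s * g_ h s) @[h --> F] --> \int[mu]_(s in K) (w s * g s).
Proof.
move=> iw ug ig_ ig.
have inw : mu.-integrable K (EFin \o (Num.norm \o w)) by exact: integrable_norm.
pose C := \int[mu]_(s in K) `|w s|.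
have C0 : 0 <= C by apply: Rintegral_ge0.
apply/cvgrPdist_le => /= e e0.
(* [C + 1] replaces [C] because [C] may be 0. *)
have eC : 0 < e / (C + 1) by rewrite divr_gt0// ltr_wpDl.
near=> h.
rewrite -RintegralB//; last by near: h.
apply: le_trans (_ : \int[mu]_(s in K) (`|w s| * (e / (C + 1))) <= _).
  have igh : mu.-integrable K (EFin \o (fun s => w s * g_ h s)) by near: h.
  have id : mu.-integrable K (EFin \o (fun s => w s * g s - w s * g_ h s)).
    by apply: eq_integrable (integrableB _ ig igh).
  apply: le_trans (le_normr_Rintegral _ id) _ => //.
  apply: le_Rintegral => //.
    exact: integrable_norm id.
    apply: eq_integrable (integrableZl _ (e / (C + 1)) inw) => // s _ /=.
    by rewrite [`|w s| * _]mulrC EFinM.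
  move=> s Ks; rewrite -mulrBr normrM ler_wpM2l//.
  rewrite distrC; move: s Ks; near: h.
  exact: ug.
rewrite RintegralZr// -/C mulrA ler_pdivrMr ?ltr_wpDl// mulrC.
by apply: ler_wpM2l; [exact: ltW|rewrite lerDl].
Unshelve. all: by end_near. Qed.

End weighted_integral.

Section parametric_integral.
Context {R : realType} {n : nat}.
Local Notation mu := (@lebesgue_measure R).
Local Notation K := (`[0%R, 1%R]%classic : set R).
Local Notation E := ('rV[R]_n * R)%type.
Implicit Types (w : R -> R) (s : R) (p v : E) (phi : E -> R).

Definition dilate s p : E := (p.1, s * p.2).

(** The weight [s ^ r] and the integrand psi give the function G; other weights arise when G is
    differentiated in t. *)
Definition dilation_integral w phi p : R :=
  \int[mu]_(s in K) (w s * phi (dilate s p)).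

Lemma dilate_continuous s p :
  (dilate z.1 z.2) @[z --> (s, p)] --> dilate s p.
Proof.
rewrite /dilate; apply: (@cvg_pair _ _ _ _ (nbhs p.1) (nbhs (s * p.2))) => /=.
  by apply: (@cvg_comp _ _ _ (snd : R * E -> E) fst); [exact: cvg_snd|exact: cvg_fst].
apply: cvgM; first exact: cvg_fst.
by apply: (@cvg_comp _ _ _ (snd : R * E -> E) snd); [exact: cvg_snd|exact: cvg_snd].
Qed.

Variables (Lam : set 'rV[R]_n) (I : set R).
Hypotheses (oLam : open Lam) (oI : open I) (itvI : is_interval I) (I0 : I 0).
Local Notation W := (Lam `*` I).

Lemma openW : open W.
Proof.
move=> p [Lp Ip]; exists (Lam, I) => //=.
by split; apply: open_nbhs_nbhs.
Qed.

(** For s in [0,1] the point s t lies between 0 and t, hence in the interval [I]. *)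
Lemma dilateW s p : K s -> W p -> W (dilate s p).
Proof.
rewrite /= in_itv/= => /andP[s0 s1] [Lp Ip]; split => //=.
have [p0|p0] := leP 0 p.2.
  by apply: (itvI I0 Ip); apply/andP; split; [exact: mulr_ge0|exact: ler_piMl].
have {}p0 := ltW p0; apply: (itvI Ip I0); apply/andP; split.
  exact: ler_niMl.
exact: mulr_ge0_le0.
Qed.

Lemma dilate_continuous_comp phi s p : (forall q, W q -> {for q, continuous phi}) ->
  K s -> W p -> phi (dilate z.1 z.2) @[z --> (s, p)] --> phi (dilate s p).
Proof.
move=> cphi Ks Wp; apply: cvg_comp; first exact: dilate_continuous.
exact/cphi/dilateW.
Qed.

Lemma dilate_within_continuous phi p : (forall q, W q -> {for q, continuous phi}) ->
  W p -> {within K, continuous (fun s => phi (dilate s p))}.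
Proof.
move=> cphi Wp; apply/continuous_in_subspaceT => s; rewrite inE => Ks.
apply: (@cvg_comp _ _ _ (fun s : R => (s, p)) (fun z => phi (dilate z.1 z.2))
  _ _ _ _ (dilate_continuous_comp cphi Ks Wp)).
by apply: (@cvg_pair _ _ _ _ (nbhs s) (nbhs p)) => //=; exact: cvg_cst.
Qed.

Lemma dilate_cvg_uniform phi p e : (forall q, W q -> {for q, continuous phi}) ->
  W p -> 0 < e ->
  \forall q \near p, forall s, K s -> `|phi (dilate s q) - phi (dilate s p)| <= e.
Proof.
move=> cphi Wp e0.
have /compact_near_coveringP : compact K by exact: segment_compact.
move=> /(_ E (nbhs p) (fun q s => K s -> `|phi (dilate s q) - phi (dilate s p)| <= e)).
move=> /(_ _) ncK; apply: filterS (ncK _) => [q + s Ks|s Ks]; first by apply.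
have e20 : 0 < e / 2 by rewrite divr_gt0.
(* At (s', q) and at (s', p) the value is compared with the one at (s, p), each within e/2; [near2]
   is the joint estimate restricted to q = p. *)
have /cvgrPdist_le /(_ _ e20) near1 := dilate_continuous_comp cphi Ks Wp.
have near2 : \forall s' \near s, `|phi (dilate s p) - phi (dilate s' p)| <= e / 2.
  have : (s', p) @[s' --> s] --> (s, p).
    by apply: (@cvg_pair _ _ _ _ (nbhs s) (nbhs p)) => //=; exact: cvg_cst.
  by move=> /(_ _ near1).
case: near1 => -[A B] /= [nA nB] AB.
exists (A `&` [set s' | `|phi (dilate s p) - phi (dilate s' p)| <= e / 2], B) => /=.
  by split=> //; apply: filterI.
move=> [s' q] /= [[As' d1] Bq] _.
have d2 := AB (s', q) (conj As' Bq).
by move: d1 d2 => /=; rewrite !ler_norml; lra.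
Qed.

Lemma dilation_integrable w phi p : mu.-integrable K (EFin \o w) ->
  (forall q, W q -> {for q, continuous phi}) -> W p ->
  mu.-integrable K (EFin \o (fun s => w s * phi (dilate s p))).
Proof.
by move=> iw cphi Wp; apply: integrable_weightM => //; exact: dilate_within_continuous.
Qed.

Lemma dilation_integral_continuous w phi p : mu.-integrable K (EFin \o w) ->
  (forall q, W q -> {for q, continuous phi}) -> W p ->
  {for p, continuous (dilation_integral w phi)}.
Proof.
move=> iw cphi Wp; apply: (cvg_weighted_integral iw).
- by move=> e e0; exact: dilate_cvg_uniform.
- have : \forall q \near p, W q by apply: open_nbhs_nbhs; split=> //; exact: openW.
  by apply: filterS => q Wq; exact: dilation_integrable.
- exact: dilation_integrable.
Qed.

Lemma dilate_line s p v h : dilate s (h *: v + p) = h *: dilate s v + dilate s p.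
Proof. by congr (_, _) => /=; rewrite mulrDr [s * (_ *: _)]mulrCA. Qed.

(* Moving p along v moves its dilate along v at speed c s. *)
Lemma coord_dir_dilate v : coord_dir v -> exists c : R -> R,
  [/\ continuous c, forall s, K s -> `|c s| <= 1 & forall s, dilate s v = c s *: v].
Proof.
case=> [[i ->]|->].
  exists (fun=> 1); split=> [s|s _|s]; first exact: cvg_cst.
    by rewrite normr1.
  by rewrite /dilate/= mulr0 scale1r.
exists id; split=> [s|s|s]; first exact: cvg_id.
  by rewrite /= in_itv/= => /andP[s0 s1]; rewrite ger0_norm.
by congr (_, _) => /=; rewrite scaler0.
Qed.

Lemma is_derive_line phi p v u :
  derivable phi (u *: v + p) v ->
  is_derive u 1 (fun u : R => phi (u *: v + p)) ('D_v phi (u *: v + p)).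
Proof.
have dlE : (fun h : R => h^-1 *: ((phi \o shift (u *: v + p)) (h *: v) - phi (u *: v + p))) =
    (fun h : R => h^-1 *: (((fun s : R => phi (s *: v + p)) \o shift u) (h *: 1) -
        phi (u *: v + p))).
  by apply/funext => h; rewrite /= [_%:A]mulr1 scalerDl addrA.
move=> dphi; split; first by move: dphi; rewrite /derivable dlE.
by rewrite /derive dlE.
Qed.

(** A form of the mean value theorem that covers both signs of h; the intermediate point is only
    located in the ball, which is all that a bound uniform on the ball requires. *)
Lemma MVT_ball (f df : R -> R) (d h : R) : `|h| < d ->
  (forall u : R, `|u| < d -> is_derive u 1 f (df u)) ->
  exists2 u, `|u| < d & f h - f 0 = df u * h.
Proof.
move=> hd fd.
have cf (a b : R) : (forall u, u \in `[a, b] -> `|u| < d) -> {within `[a, b], continuous f}.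
  move=> abd; apply: derivable_within_continuous => u /abd/fd.
  by case.
have [h0|h0] := leP 0 h.
  have hu u : u \in `[0, h] -> `|u| < d.
    rewrite in_itv/= => /andP[u0 uh]; move: hd; rewrite !ger0_norm//.
    exact: le_lt_trans.
  have [|u u0h ->] := MVT_segment (df := df) h0 _ (cf _ _ hu).
    by move=> u u0h; apply/fd/hu; exact: subset_itv_oo_cc.
  by exists u; [exact: hu|rewrite subr0].
have hu u : u \in `[h, 0] -> `|u| < d.
  rewrite in_itv/= => /andP[u0 uh]; move: hd; rewrite (ltr0_norm h0) ler0_norm//.
  by apply: le_lt_trans; rewrite lerN2.
have [|u u0h fh] := MVT_segment (df := df) (ltW h0) _ (cf _ _ hu).
  by move=> u u0h; apply/fd/hu; exact: subset_itv_oo_cc.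
by exists u; [exact: hu|rewrite -opprB fh sub0r mulrN opprK].
Qed.

(* By the mean value theorem the difference quotients of the integrand converge
   uniformly in s; the chain-rule factor c is absorbed in the weight. *)
Lemma dilation_integral_is_derive w phi p v (c : R -> R) :
  mu.-integrable K (EFin \o w) -> continuous c ->
  (forall s, K s -> `|c s| <= 1) -> (forall s, dilate s v = c s *: v) ->
  (forall q, W q -> {for q, continuous phi}) ->
  (forall q, W q -> derivable phi q v) ->
  (forall q, W q -> {for q, continuous ('D_v phi)}) -> W p ->
  is_derive p v (dilation_integral w phi)
    (dilation_integral (fun s => w s * c s) ('D_v phi) p).
Proof.
move=> iw cc c1 cv cphi dphi cDphi Wp.
have Wnear : \forall q \near p, W q by apply: open_nbhs_nbhs; split=> //; exact: openW.
have line_near (P : E -> Prop) : (\forall q \near p, P q) ->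
    \forall h \near (0 : R), P (h *: v + p).
  have : h *: v + p @[h --> (0 : R)] --> p.
    have : {for (0 : R), continuous (fun h : R => h *: v + p)}.
      by apply: cvgD; [exact: scalel_continuous|exact: cvg_cst].
    by rewrite /prop_for /continuous_at scale0r add0r.
  by move=> + nP => /(_ _ nP).
pose g_ (h s : R) : R := h^-1 * (phi (dilate s (h *: v + p)) - phi (dilate s p)).
pose g (s : R) : R := c s * 'D_v phi (dilate s p).
have cg : {within K, continuous g}.
  have cD := dilate_within_continuous cDphi Wp.
  by move=> x; apply: cvgM; [exact: (continuous_subspaceT cc)|exact: cD].
have cvgG : \int[mu]_(s in K) (w s * g_ h s) @[h --> 0^'] --> \int[mu]_(s in K) (w s * g s).
  apply: (cvg_weighted_integral iw); last exact: integrable_weightM.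
    move=> e e0.
    (* On this ball p + u v stays in the domain, and the derivative of [phi] at its dilates is
       e-close to that at the dilates of p, for all s at once. The intermediate point found below
       depends on s, so this uniformity is essential. *)
    have [d /= d0 Pd] := (nbhs_ballP _ _).1
      (line_near _ (filterI Wnear (dilate_cvg_uniform cDphi Wp e0))).
    exists d => //= h hd h0 s Ks.
    pose f (u : R) : R := phi (dilate s (u *: v + p)).
    pose df (u : R) : R := 'D_v phi (dilate s (u *: v + p)) * c s.
    have fd (u : R) : `|u| < d -> is_derive u 1 f (df u).
      move=> ud; have [|Wu _] := Pd u; first by rewrite /ball/= sub0r normrN.
      (* The dilated line is again a line in direction v, run at speed [c s]; hence the factor [c s]
         in [df]. *)
      have lineE x : dilate s (x *: v + p) = (c s * x) *: v + dilate s p.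
        by rewrite dilate_line cv scalerA mulrC.
      have -> : f = (fun x => phi (x *: v + dilate s p)) \o ( *%R (c s)).
        by apply/funext => x /=; rewrite /f lineE.
      apply: is_derive1_comp.
        rewrite lineE; apply: is_derive_line; rewrite -lineE.
        exact/dphi/dilateW.
      have := @is_deriveZ _ _ _ id (c s) u 1 1 (is_derive_id u 1).
      by rewrite [_ *: _]mulr1.
    have hd' : `|h| < d by move: hd; rewrite /ball/= sub0r normrN.
    have [u ud fE] := MVT_ball hd' fd.
    have [|_ /(_ s Ks) Du] := Pd u; first by rewrite /ball/= sub0r normrN.
    have -> : g_ h s = df u.
      rewrite /g_ (_ : phi (dilate s p) = f 0); last by rewrite /f scale0r add0r.
      by rewrite -[phi _]/(f h) fE mulrC mulfK.
    rewrite /df /g mulrC -mulrBr normrM.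
    by rewrite (le_trans _ Du)// ler_piMl// c1.
  near=> h; apply: integrable_weightM => //.
  have Wh : W (h *: v + p) by near: h; apply: cvg_within; exact: line_near.
  have c1' := dilate_within_continuous cphi Wh.
  have c2' := dilate_within_continuous cphi Wp.
  move=> x; apply: cvgM; first exact: cvg_cst.
  by apply: cvgB; [exact: c1'|exact: c2'].
have E1 : (fun h : R => h^-1 *: ((dilation_integral w phi \o shift p) (h *: v)
    - dilation_integral w phi p)) @ 0^' --> dilation_integral (fun s => w s * c s) ('D_v phi) p.
  rewrite (_ : dilation_integral _ ('D_v phi) p = \int[mu]_(s in K) (w s * g s)); last first.
    by apply: eq_Rintegral => s _; rewrite /g mulrA.
  apply: cvg_trans cvgG; apply: near_eq_cvg; near=> h.
  have Wh : W (h *: v + p) by near: h; apply: cvg_within; exact: line_near.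
  have ih := dilation_integrable iw cphi Wh.
  have ip := dilation_integrable iw cphi Wp.
  have -> : ((fun h : R => h^-1 *: ((dilation_integral w phi \o shift p) (h *: v)
      - dilation_integral w phi p)) h) =
      h^-1 * (dilation_integral w phi (h *: v + p) - dilation_integral w phi p) by [].
  rewrite -RintegralB// -RintegralZl//.
    by apply: eq_Rintegral => s _; rewrite /g_ -mulrBr mulrCA.
  by apply: eq_integrable (integrableB _ ih ip).
by split; [apply/cvg_ex; eexists; exact: E1|exact: cvg_lim E1].
Unshelve. all: by end_near. Qed.

(** A derivative along v has the same shape, with weight [w s * c s] and integrand the derivative of
    [phi]; [c] is continuous, so the new weight is integrable and the induction hypothesis, general
    in both, applies. *)
Lemma Ck_dilation_integral k w phi : mu.-integrable K (EFin \o w) ->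
  Ck k W phi -> Ck k W (dilation_integral w phi).
Proof.
elim: k w phi => [|k IH] w phi iw Cphi; have [cphi dphi] := Cphi.
  by split=> // p Wp; exact: dilation_integral_continuous.
split=> [p Wp|v cv]; first exact: dilation_integral_continuous.
have [c [cc c1 cvE]] := coord_dir_dilate cv.
have [dv Dk] := dphi v cv.
have D p : W p -> _ := dilation_integral_is_derive iw cc c1 cvE cphi dv
  (fun q => Ck_continuous Dk).
split=> [p /D[]//|].
have iwc : mu.-integrable K (EFin \o (fun s => w s * c s)).
  by apply: integrable_weightM => //; exact: continuous_subspaceT.
apply: Ck_eq (IH _ _ iwc Dk); first exact: openW.
by move=> p; rewrite inE => /D[_ ->].
Qed.

End parametric_integral.

(** * Scaling of the Lebesgue integral *)

Section lebesgue_scaling.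
Context {R : realType}.
Local Notation mu := (@lebesgue_measure R).
Implicit Types (c t : R) (D : set R).

Lemma mulr_measurable c :
  measurable_fun [set: measurableTypeR R] ( *%R c : measurableTypeR R -> measurableTypeR R).
Proof. exact: measurable_funM. Qed.

(** The pushforward under multiplication by c, scaled by |c|, gives half-open intervals their
    length, and this characterizes Lebesgue measure. *)
Lemma lebesgue_measure_scale c (D : set R) : c != 0 -> measurable D ->
  mu D = (`|c|%:E * mu ( *%R c @^-1` D))%E.
Proof.
move=> c0 mD.
pose mc : {mfun measurableTypeR R >-> measurableTypeR R} :=
  HB.pack ( *%R c : measurableTypeR R -> measurableTypeR R)
    (isMeasurableFun.Build _ _ _ _ _ (mulr_measurable c)).
rewrite (@lebesgue_measure_unique _
  (mscale `|c|%:nng (pushforward mu mc) : {measure set _ -> \bar R}))//=.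
move=> _ [[a b] _ <-]; rewrite /mscale/= /pushforward/=.
have [ab|ba] := ltP a b; last first.
  rewrite set_itv_ge ?bnd_simp -?leNgt// preimage_set0 !measure0 mule0//.
rewrite lebesgue_measure_itv/= lte_fin ab.
have [c_gt0|c_lt0] := leP 0 c.
  have {}c_gt0 : 0 < c by rewrite lt_def c0.
  rewrite (_ : _ @^-1` _ = `]a / c, b / c]%classic); last first.
    by apply/seteqP; split=> x /=; rewrite !in_itv/= ltr_pdivrMr// ler_pdivlMr// (mulrC c).
  rewrite lebesgue_measure_itv/= lte_fin ltr_pM2r ?invr_gt0// ab gtr0_norm//.
  by rewrite -!EFinD -EFinM; congr EFin; field.
(* A negative c reverses the order, so the closed end of the interval moves to the left. *)
rewrite (_ : _ @^-1` _ = `[b / c, a / c[%classic); last first.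
  apply/seteqP; split=> x /=; rewrite !in_itv/= ltr_ndivlMr// ler_ndivrMr// (mulrC c) andbC//.
rewrite lebesgue_measure_itv/= lte_fin ltr_nM2r ?invr_lt0// ab ltr0_norm//.
by rewrite -!EFinD -EFinM; congr EFin; field.
Qed.

Lemma ge0_integral_scale c (D : set R) (f : R -> \bar R) : c != 0 -> measurable D ->
  measurable_fun D f -> (forall x, D x -> 0 <= f x)%E ->
  (\int[mu]_(x in D) f x = `|c|%:E * \int[mu]_(x in *%R c @^-1` D) f (c * x)%R)%E.
Proof.
move=> c0 mD mf f0.
pose mc : {mfun measurableTypeR R >-> measurableTypeR R} :=
  HB.pack ( *%R c : measurableTypeR R -> measurableTypeR R)
    (isMeasurableFun.Build _ _ _ _ _ (mulr_measurable c)).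
rewrite (@eq_measure_integral _ _ _ _
  (mscale `|c|%:nng (pushforward mu mc) : {measure set _ -> \bar R})); last first.
  by move=> A mA _; exact: lebesgue_measure_scale.
by rewrite ge0_integral_mscale// ge0_integral_pushforward// => y; rewrite inE; exact: f0.
Qed.

Lemma preimage_scale_measurable c D : measurable D -> measurable ( *%R c @^-1` D).
Proof.
by move=> mD; rewrite -[X in measurable X]setTI; exact: mulr_measurable.
Qed.

Lemma measurable_fun_scale c D (f : R -> R) : measurable D ->
  measurable_fun D f -> measurable_fun ( *%R c @^-1` D) (fun x => f (c * x)).
Proof.
move=> mD mf.
apply: (@measurable_comp _ _ _ _ _ _ D f) => //.
by move=> _ [x Dx <-].
Qed.

Lemma integrable_scale c D (f : R -> R) : c != 0 -> measurable D ->
  measurable_fun D f ->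
  mu.-integrable D (EFin \o f) <->
  mu.-integrable ( *%R c @^-1` D) (EFin \o (fun x => f (c * x))).
Proof.
move=> c0 mD mf.
have c_gt0 : 0 < `|c| by rewrite normr_gt0.
have iE : (\int[mu]_(x in D) `|(EFin \o f) x| =
    `|c|%:E * \int[mu]_(x in *%R c @^-1` D) `|(EFin \o (fun x => f (c * x)%R)) x|)%E.
  by rewrite (ge0_integral_scale c0)//; do 2 apply: measurableT_comp => //.
split=> /integrableP[_ fi]; apply/integrableP; split.
- by apply/measurable_EFinP; exact: measurable_fun_scale mD mf.
(* Infinity is written as |c| times infinity so that the factor |c| cancels. *)
- by move: fi; rewrite iE -[X in (_ < X)%E](@gt0_muley _ `|c|%:E) ?lte_pmul2l ?lte_fin.
- exact/measurable_EFinP.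
- by rewrite iE; apply: lte_mul_pinfty.
Qed.

Lemma Rintegral_scale c D (f : R -> R) : c != 0 -> measurable D ->
  mu.-integrable D (EFin \o f) ->
  \int[mu]_(x in D) f x = `|c| * \int[mu]_(x in *%R c @^-1` D) f (c * x).
Proof.
move=> c0 mD fi; have mf : measurable_fun D f by case/integrableP: fi => /measurable_EFinP.
have ci := (integrable_scale c0 mD mf).1 fi.
rewrite /Rintegral -[`|c|]/(fine `|c|%:E) -fineM//; last first.
  by apply: integrable_fin_num => //; exact: preimage_scale_measurable.
congr fine; rewrite integralE [in RHS]integralE.
(* Finiteness of the positive part lets |c| distribute over the difference of the two parts in the
   extended reals. *)
have fin_pos : (\int[mu]_(x in *%R c @^-1` D) (EFin \o (fun x => f (c * x)%R))^\+ x)%E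
    \is a fin_num.
  apply: integrable_fin_num; first exact: preimage_scale_measurable.
  by apply: integrable_funepos => //; exact: preimage_scale_measurable.
rewrite muleBr//; last by rewrite fin_num_adde_defr.
congr (_ - _)%E; rewrite (ge0_integral_scale c0)//.
- by congr (_ * _)%E; apply: eq_integral => x _; rewrite !funeposE.
- by apply: measurable_funepos; exact/measurable_EFinP.
- by congr (_ * _)%E; apply: eq_integral => x _; rewrite !funenegE.
- by apply: measurable_funeneg; exact/measurable_EFinP.
Qed.

End lebesgue_scaling.

(** * Integrals of powers *)

Section power_integrals.
Context {R : realType}.
Local Notation mu := (@lebesgue_measure R).
Local Notation K := (`[0%R, 1%R]%classic : set R).
Implicit Types (r a b : R).

Lemma integral_is_derive (F f : R -> R) a b : 0 < a -> a < b ->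
  (forall x : R, 0 < x -> is_derive x 1 F (f x)) ->
  (forall x : R, 0 < x -> {for x, continuous f}) ->
  (\int[mu]_(x in `[a, b]) (f x)%:E = (F b - F a)%:E)%E.
Proof.
move=> a0 ab dF cf.
have cF (x : R) : 0 < x -> {for x, continuous F}.
  by move=> /dF[dFx _]; apply/differentiable_continuous/derivable1_diffP.
have pos x : x \in `[a, b] -> 0 < x by rewrite in_itv/= => /andP[/(lt_le_trans a0)].
rewrite (@continuous_FTC2 _ f F) ?EFinB//.
- by apply/continuous_in_subspaceT => x; rewrite inE => /pos/cf.
- split.
  + by move=> x /subset_itv_oo_cc/pos/dF[].
  + by apply: cvg_at_right_filter; apply: cF.
  + by apply: cvg_at_left_filter; apply: cF; exact: lt_trans ab.
- by move=> x /subset_itv_oo_cc/pos/dF[_ <-]; rewrite derive1E.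
Qed.

Lemma powR_continuous_gt0 r (x : R) : 0 < x -> {for x, continuous (fun y : R => y `^ r)}.
Proof.
move=> x0; have [d _] := is_derive1_powR r x0.
exact/differentiable_continuous/derivable1_diffP.
Qed.

Lemma integral_powR_itv r a b : r + 1 != 0 -> 0 < a -> a < b ->
  (\int[mu]_(x in `[a, b]) (x `^ r)%:E =
    ((b `^ (r + 1) - a `^ (r + 1)) / (r + 1))%:E)%E.
Proof.
move=> r1 a0 ab.
apply: etrans (@integral_is_derive (fun x => (r + 1)^-1 * x `^ (r + 1)) (fun x => x `^ r)
  _ _ a0 ab _ _) _.
- move=> x x0; have := is_derive1_powR (r + 1) x0.
  move=> /(@is_deriveZ _ _ _ _ (r + 1)^-1).
  by rewrite addrK [_ *: (_ * _)]mulKf.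
- by move=> x; exact: powR_continuous_gt0.
- by rewrite -mulrBr mulrC.
Qed.

Lemma measurable_powR_EFin r (D : set R) :
  measurable_fun D (fun x : R => (x `^ r)%:E).
Proof. by apply/measurable_EFinP; apply: measurable_funTS; exact: measurable_powR. Qed.

(** Monotone convergence along [1/(k+1), 1], where the explicit primitive bounds every integral by
    1/(r+1). *)
Lemma powR_integrable r : -1 < r -> mu.-integrable K (EFin \o (fun s : R => s `^ r)).
Proof.
move=> r1; have r1_gt0 : 0 < r + 1 by rewrite -(opprK 1) subr_gt0.
apply/integrableP; split; first exact: measurable_powR_EFin.
under eq_integral do rewrite /= ger0_norm ?powR_ge0//.
rewrite -integral_itv_obnd_cbnd; last exact: measurable_powR_EFin.
rewrite itv_open_bnd_bigcup.
have cvgI := @ge0_nondecreasing_set_cvg_integral _ (measurableTypeR R) R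
  (fun k => `[0 + k.+1%:R^-1 : R, 1 : R]%classic)
  (fun s : R => (s `^ r)%:E) mu.
apply: (@le_lt_trans _ _ ((r + 1)^-1)%:E); last exact: ltry.
apply: cvge_le (cvgI _ _ _ _) => //.
(* For k = 0 the interval is the single point 1, which the formula for a < b does not cover. *)
- apply: nearW => k; have [k0|k0] := eqVneq k 0%N.
    by rewrite k0 invr1 add0r set_itv1 integral_set1 lee_fin invr_ge0 ltW.
  have k1 : (k.+1%:R^-1 : R) < 1 by rewrite invf_lt1// ltr1n ltnS lt0n.
  rewrite add0r integral_powR_itv ?gt_eqF// lee_fin.
  by rewrite ler_pdivrMr// mulVf ?gt_eqF// powR1 lerBlDr lerDl powR_ge0.
- move=> m k mk; apply/subsetPset => x /=; rewrite !in_itv/= !add0r => /andP[+ ->].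
  rewrite andbT; apply: le_trans.
  by rewrite lef_pV2 ?posrE// ler_nat ltnS.
- by move=> k; exact: measurable_powR_EFin.
- by move=> k x _; rewrite lee_fin powR_ge0.
Qed.

Lemma Rintegral_powR_gt0 r : -1 < r -> 0 < \int[mu]_(s in K) (s `^ r).
Proof.
move=> r1; have r1_gt0 : 0 < r + 1 by rewrite -(opprK 1) subr_gt0.
have ir := powR_integrable r1.
have sub : `[2^-1, 1]%classic `<=` K.
  by move=> x /=; rewrite !in_itv/= => /andP[/(le_trans _) -> //->].
apply: (@lt_le_trans _ _ (\int[mu]_(s in `[2^-1, 1]) (s `^ r))).
  rewrite /Rintegral integral_powR_itv ?gt_eqF// ?invf_lt1 ?ltr1n// divr_gt0//.
  rewrite subr_gt0 gt0_ltr_powR// ?nnegrE// ?invf_lt1 ?ltr1n//.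
apply: fine_le.
- by apply: integrable_fin_num => //; exact: integrableS ir.
- exact: integrable_fin_num.
- apply: ge0_subset_integral => //; first exact: measurable_powR_EFin.
  by move=> x _; rewrite lee_fin powR_ge0.
Qed.

(** Comparison with k/s, whose integral over [a, d] grows like a logarithm as a tends to 0. *)
Lemma inv_not_integrable (h : R -> R) (k d : R) : 0 < k -> 0 < d -> d <= 1 ->
  (forall s, 0 < s -> s <= d -> k * s^-1 <= `|h s|) ->
  ~ mu.-integrable K (EFin \o h).
Proof.
move=> k0 d0 d1 kh ih.
have inh : mu.-integrable K (EFin \o (Num.norm \o h)) by exact: integrable_norm.
pose M := \int[mu]_(s in K) `|h s|.
have M0 : 0 <= M by apply: Rintegral_ge0.
(* Chosen so that k/x has integral k ln (d/a) = M + k over [a, d], which exceeds the supposed total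
   [M]. *)
pose a := d * expR (- (M / k + 1)).
have a0 : 0 < a by rewrite mulr_gt0// expR_gt0.
have ad : a < d.
  by rewrite gtr_pMr// -expR0 ltr_expR oppr_lt0 ltr_wpDl// divr_ge0// ltW.
have sub : `[a, d]%classic `<=` K.
  move=> x /=; rewrite !in_itv/= => /andP[ax xd].
  by rewrite (le_trans (ltW a0) ax) (le_trans xd d1).
have inad : mu.-integrable `[a, d] (EFin \o (Num.norm \o h)) by apply: integrableS inh.
have cinv (x : R) : 0 < x -> {for x, continuous (fun y : R => k * y^-1)}.
  by move=> x0; apply: cvgM; [exact: cvg_cst|apply: cvgV; [rewrite gt_eqF|exact: cvg_id]].
have lnI : (\int[mu]_(x in `[a, d]) (k * x^-1)%:E = (k * ln d - k * ln a)%:E)%E.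
  apply: (@integral_is_derive (fun x => k * ln x) (fun x => k * x^-1)) => // x x0.
  by apply: is_deriveZ; exact: is_derive1_ln.
have : (\int[mu]_(x in `[a, d]) (k * x^-1)%:E <= \int[mu]_(x in K) (`|h x|)%:E)%E.
  apply: (@le_trans _ _ (\int[mu]_(x in `[a, d]) (`|h x|)%:E)%E).
    apply: ge0_le_integral => //.
    - move=> x /=; rewrite in_itv/= => /andP[/(lt_le_trans a0) x0 _].
      by rewrite lee_fin mulr_ge0// ?invr_ge0 ltW.
    - have cinv_ad : {within `[a, d], continuous (fun y : R => k * y^-1)}.
        apply/continuous_in_subspaceT => x; rewrite inE/= in_itv/= => /andP[ax _].
        exact/cinv/(lt_le_trans a0).
      by apply/measurable_EFinP; exact: subspace_continuous_measurable_fun.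
    - by case/integrableP: inad.
    - move=> x /=; rewrite in_itv/= => /andP[/(lt_le_trans a0) x0 xd].
      by rewrite lee_fin kh.
  by apply: ge0_subset_integral => //; case/integrableP: inh.
rewrite lnI -[X in (_ <= X)%E]fineK; last exact: integrable_fin_num inh.
rewrite lee_fin -/M -mulrBr.
rewrite /a lnM ?posrE ?expR_gt0// expRK opprD addrA subrr add0r opprK.
by rewrite mulrDr mulr1 mulrC divfK ?gt_eqF// gerDl leNgt k0.
Qed.

End power_integrals.

(** * The integral defining F *)

Section power_integral_scaling.
Context {R : realType} (r : R).
Local Notation mu := (@lebesgue_measure R).
Local Notation K := (`[0%R, 1%R]%classic : set R).
Local Notation J t := (`[Num.min 0 t, Num.max 0 t]%classic : set R).
Implicit Types (g : R -> R) (t : R).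

Lemma scale_preimage_segment t : t != 0 -> *%R t @^-1` J t = K.
Proof.
move=> t0; have xE x : (t * x \in `[Num.min 0 t, Num.max 0 t]) = (x \in `[0, 1]).
  rewrite !in_itv/=; have [t_ge0|t_lt0] := leP 0 t.
    have t_gt0 : 0 < t by rewrite lt_def t0.
    by rewrite pmulr_rge0// -[X in _ && (_ <= X)]mulr1 ler_pM2l.
  by rewrite nmulr_rle0// -[X in X <= t * x]mulr1 ler_nM2l// andbC.
by apply/seteqP; split=> x /=; rewrite xE.
Qed.

Lemma weighted_scale g t : {in K, (fun s => weighted r g (t * s)) =1
  (fun s => `|t| `^ r * (s `^ r * g (s * t)))}.
Proof.
move=> s; rewrite inE/= in_itv/= => /andP[s0 _].
by rewrite /weighted normrM powRM// (ger0_norm s0) (mulrC t) mulrA.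
Qed.

Lemma weighted_measurable g t : {within J t, continuous g} ->
  measurable_fun (J t) (weighted r g).
Proof.
move=> cg; apply: measurable_funM; last exact: subspace_continuous_measurable_fun.
apply: (@measurableT_comp _ _ _ _ _ _ (fun y : R => y `^ r) _ (@Num.norm _ R)).
  exact: measurable_powR.
exact: measurable_funTS.
Qed.

Lemma convergesE g t : t != 0 -> {within J t, continuous g} ->
  converges r g t <-> mu.-integrable K (EFin \o (fun s => s `^ r * g (s * t))).
Proof.
move=> t0 cg.
have tr0 : `|t| `^ r != 0 by rewrite gt_eqF// powR_gt0// normr_gt0.
have := integrable_scale t0 _ (weighted_measurable cg).
rewrite /converges scale_preimage_segment// => -> //.
split=> ih.
  have := integrableZl _ (`|t| `^ r)^-1 ih.
  move=> /(_ (measurable_itv _)); apply: eq_integrable => // s sK /=.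
  by rewrite weighted_scale// -EFinM mulKf.
have := integrableZl _ (`|t| `^ r) ih.
move=> /(_ (measurable_itv _)); apply: eq_integrable => // s sK /=.
by rewrite weighted_scale// EFinM.
Qed.

(** Scaling yields the factor |t|; for t < 0 the orientation sign of the integral turns it into
    t. *)
Lemma power_integralE g t : t != 0 -> {within J t, continuous g} -> converges r g t ->
  power_integral r g t = t * `|t| `^ r * \int[mu]_(s in K) (s `^ r * g (s * t)).
Proof.
move=> t0 cg cv.
have icv := (convergesE t0 cg).1 cv.
have E : \int[mu]_(x in J t) weighted r g x =
    `|t| * `|t| `^ r * \int[mu]_(s in K) (s `^ r * g (s * t)).
  rewrite (Rintegral_scale t0)// scale_preimage_segment// -mulrA; congr (_ * _).
  by rewrite -RintegralZl//; apply: eq_Rintegral => s sK; rewrite weighted_scale.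
rewrite /power_integral.
have [t_ge0|t_lt0] := leP 0 t.
  by move: E; rewrite min_l// max_r// (ger0_norm t_ge0).
move: E; rewrite min_r ?ltW// max_l ?ltW// => ->.
by rewrite ltr0_norm// !mulNr opprK.
Qed.

(** The root of order r + 1 undoes exactly the factor |t|^(r+1), and the sign of t restores t from
    |t|. *)
Lemma root_integralE g t : -1 < r -> t != 0 -> {within J t, continuous g} ->
  converges r g t -> root_integral r g t =
    t * `|\int[mu]_(s in K) (s `^ r * g (s * t))| `^ (r + 1)^-1.
Proof.
move=> r1 t0 cg cv; rewrite /root_integral power_integralE//.
have r1_gt0 : 0 < r + 1 by rewrite -(opprK 1) subr_gt0.
rewrite !normrM (ger0_norm (powR_ge0 _ r)) powRM ?mulr_ge0 ?powR_ge0//.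
have -> : `|t| * `|t| `^ r = `|t| `^ (r + 1).
  by rewrite -[in LHS](addrK 1 r) mulr_powRB1.
by rewrite -powRrM mulfV ?gt_eqF// powRr1// mulrA -numEsg.
Qed.

End power_integral_scaling.

(** * Convergence of the integral, regularity of F, and its derivative at 0 *)

Lemma Cq_continuous (R : realType) (n : nat) (q : option nat) (U : set ('rV[R]_n * R))
    (f : 'rV[R]_n * R -> R) p : Cq q U f -> U p -> {for p, continuous f}.
Proof.
case: q => [k|] Cf; first exact: Ck_continuous Cf.
exact: Ck_continuous (Cf 0%N).
Qed.

Section root_integral_structure.
Context {R : realType} {n : nat} (Lam : set 'rV[R]_n) (I : set R)
  (psi : 'rV[R]_n -> R -> R) (r : R).
Hypotheses (oLam : open Lam) (oI : open I) (itvI : is_interval I) (I0 : I 0).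
Local Notation mu := (@lebesgue_measure R).
Local Notation K := (`[0%R, 1%R]%classic : set R).
Local Notation W := (Lam `*` I).
Local Notation phi := (fun p : 'rV[R]_n * R => psi p.1 p.2).
Hypothesis cphi : forall p, W p -> {for p, continuous phi}.
Hypothesis psi_gt0 : forall lam, Lam lam -> 0 < psi lam 0.

Local Notation G := (dilation_integral (fun s => s `^ r) phi).

Lemma slice_continuous lam t : Lam lam -> I t -> {for t, continuous (psi lam)}.
Proof.
move=> Ll It.
have cp : {for (lam, t), continuous phi} by exact: cphi.
apply: (@cvg_comp _ _ _ (fun x : R => (lam, x)) phi _ (nbhs (lam, t)) _ _ cp).
by apply: (@cvg_pair _ _ _ _ (nbhs lam) (nbhs t)) => //=; exact: cvg_cst.
Qed.

Lemma slice_within_continuous lam t : Lam lam -> I t ->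
  {within `[Num.min 0 t, Num.max 0 t], continuous (psi lam)}.
Proof.
move=> Ll It; apply/continuous_in_subspaceT => x; rewrite inE/= in_itv/= => xt.
apply: slice_continuous => //.
move: xt; have [t0|/ltW t0] := leP 0 t; first exact: itvI I0 It _.
exact: itvI It I0 _.
Qed.

Lemma converges_iff lam t : Lam lam -> I t -> t != 0 ->
  converges r (psi lam) t <-> -1 < r.
Proof.
move=> Ll It t0; have cg := slice_within_continuous Ll It.
split=> [/(convergesE r t0 cg).1 ih|r1]; last first.
  apply/(convergesE r t0 cg).
  exact: (dilation_integrable itvI I0 (powR_integrable r1) cphi (p := (lam, t))).
rewrite ltNge; apply/negP => r1.
pose k := psi lam 0 / 2; have k0 : 0 < k by rewrite divr_gt0// psi_gt0.
have [d /= d0 kd] : \forall s \near (0 : R), k < psi lam (s * t).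
  have : psi lam (s * t) @[s --> (0 : R)] --> psi lam 0.
    have cm : {for (0 : R), continuous (fun s : R => s * t)}.
      by apply: cvgM; [exact: cvg_id|exact: cvg_cst].
    have cp : {for (0 * t), continuous (psi lam)} by rewrite mul0r; exact: slice_continuous.
    by have := continuous_comp cm cp; rewrite /prop_for/continuous_at/= mul0r.
  move=> /cvgr_gt; apply.
  by rewrite ltr_pdivrMr// ltr_pMr ?psi_gt0// ltr1n.
(* The bound 1 gives s^r >= 1/s for r <= -1; halving d makes the closed condition on s imply the
   open one, |s| < d. *)
apply: (@inv_not_integrable _ _ k (Num.min 1 (d / 2)) k0 _ _ _ ih).
- by rewrite lt_min ltr01 divr_gt0.
- by rewrite ge_min lexx.
move=> s s0; rewrite le_min => /andP[s1 sd].
have kg : k < psi lam (s * t).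
  apply: kd; rewrite /= sub0r normrN gtr0_norm// (le_lt_trans sd)//.
  by rewrite ltr_pdivrMr// ltr_pMr// ltr1n.
rewrite normrM ger0_norm ?powR_ge0// mulrC.
apply: ler_pM; [by rewrite invr_ge0 ltW|exact: ltW| |].
  by rewrite -(powR_inv1 (ltW s0)) ger_powR// s0.
exact: le_trans (ltW kg) (ler_norm _).
Qed.

Hypothesis r1 : -1 < r.

Lemma dilation_integral_gt0 lam : Lam lam -> 0 < G (lam, 0).
Proof.
move=> Ll.
have -> : G (lam, 0) = \int[mu]_(s in K) (s `^ r * psi lam 0).
  by apply: eq_Rintegral => s _; rewrite /= mulr0.
rewrite RintegralZr//; last exact: powR_integrable.
by rewrite mulr_gt0 ?psi_gt0// Rintegral_powR_gt0.
Qed.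

(** At t = 0 both sides vanish through the factors [Num.sg t] and t, so one formula holds on all of
    [I]. *)
Lemma root_integral_dilation lam t : Lam lam -> I t ->
  root_integral r (psi lam) t = t * `|G (lam, t)| `^ (r + 1)^-1.
Proof.
move=> Ll It; have [->|t0] := eqVneq t 0.
  by rewrite /root_integral sgr0 !mul0r.
by rewrite root_integralE//; [exact: slice_within_continuous|exact/converges_iff].
Qed.

(** For t <> 0 the integral is G times a nonzero factor, and at t = 0 G is positive; the two
    alternatives thus merge into one condition, open because G is continuous. *)
Lemma regular_domE : regular_dom r Lam I psi = [set p | W p /\ G p != 0].
Proof.
apply/seteqP; split=> [[lam t] /= [Ll It tP]|[lam t] /= [[Ll It] Gt]].
  split=> //; have [t0|t0] := eqVneq t 0.
    by rewrite t0 gt_eqF// dilation_integral_gt0.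
  case: tP => [/eqP|]; first by rewrite (negPf t0).
  rewrite power_integralE//; last 2 first.
  - exact: slice_within_continuous.
  - exact/converges_iff.
  by apply: contra_notN => /eqP; rewrite /dilation_integral/= => ->; rewrite mulr0.
split=> //; have [t0|t0] := eqVneq t 0; [by left|right].
rewrite power_integralE//; last 2 first.
- exact: slice_within_continuous.
- exact/converges_iff.
apply/eqP; rewrite !mulf_neq0// gt_eqF// powR_gt0// normr_gt0//.
Qed.

Lemma G_continuous p : W p -> {for p, continuous G}.
Proof.
by move=> Wp; apply: dilation_integral_continuous Wp => //; exact: powR_integrable.
Qed.

Lemma regular_dom_open : open (regular_dom r Lam I psi).
Proof.
rewrite regular_domE openE => p [Wp Gp0].
apply: filterI; first by apply: open_nbhs_nbhs; split=> //; exact: openW.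
exact: (cvgr_neq0 _ (G_continuous Wp) Gp0).
Qed.

Lemma Ck_root_integral k : Ck k W phi ->
  Ck k (regular_dom r Lam I psi) (fun p => root_integral r (psi p.1) p.2).
Proof.
move=> Cphi; have oU := regular_dom_open.
have UW : regular_dom r Lam I psi `<=` W by move=> p [].
have CG : Ck k (regular_dom r Lam I psi) G.
  apply: Ck_sub UW _.
  by apply: Ck_dilation_integral => //; exact: powR_integrable.
have G0 p : regular_dom r Lam I psi p -> G p != 0 by rewrite regular_domE => -[].
apply: Ck_eq (CkM oU (Ck_snd k _) (Ck_powR_norm (r + 1)^-1 oU G0 CG)) => //.
by move=> [lam t]; rewrite inE => /UW[Ll It]; rewrite /= root_integral_dilation.
Qed.

(* The difference quotient at 0 is exactly |G(lam, h)|^(1/(r+1)). *)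
Lemma root_integral_is_derive0 lam : Lam lam ->
  is_derive (0 : R) 1 (root_integral r (psi lam)) (`|G (lam, 0)| `^ (r + 1)^-1).
Proof.
move=> Ll.
have cvgD : (fun h : R => h^-1 *: ((root_integral r (psi lam) \o shift 0) (h *: 1) -
    root_integral r (psi lam) 0)) @ 0^' --> `|G (lam, 0)| `^ (r + 1)^-1.
  have cG : (fun h : R => `|G (lam, h)| `^ (r + 1)^-1) @ (0 : R)^' -->
      `|G (lam, 0)| `^ (r + 1)^-1.
    apply: cvg_within_filter.
    have cpair : {for (0 : R), continuous (fun h : R => (lam, h))}.
      by apply: (@cvg_pair _ _ _ _ (nbhs lam) (nbhs (0 : R))) => //=; exact: cvg_cst.
    (* Positivity of G(lam, 0) keeps the power away from its possible singularity at 0. *)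
    have cpow : {for G (lam, 0), continuous (fun y : R => `|y| `^ (r + 1)^-1)}.
      apply/differentiable_continuous/derivable1_diffP.
      by have [] := is_derive_powR_norm (r + 1)^-1 (lt0r_neq0 (dilation_integral_gt0 Ll)).
    have cG0 : {for (lam, 0 : R), continuous G} by exact: G_continuous.
    have cGl : {for (0 : R), continuous (G \o (fun h : R => (lam, h)))}.
      exact: continuous_comp cpair cG0.
    exact: (@continuous_comp _ _ _ (G \o (fun h : R => (lam, h)))
      (fun y : R => `|y| `^ (r + 1)^-1) 0 cGl cpow).
  apply: cvg_trans cG; apply: near_eq_cvg; near=> h.
  have Ih : I h by near: h; apply: cvg_within; apply: open_nbhs_nbhs.
  have h0 : h != 0 by near: h; exact: nbhs_dnbhs_neq.
  rewrite /= addr0 [h *: 1]mulr1 !root_integral_dilation// mul0r subr0.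
  by rewrite [_ *: _]mulKf.
by split; [apply/cvg_ex; eexists; exact: cvgD|exact: cvg_lim cvgD].
Unshelve. all: by end_near. Qed.

End root_integral_structure.

Unset Implicit Arguments.

Theorem theorem21 (R : realType) (n : nat) (Lam : set 'rV[R]_n) (I : set R)
    (psi : 'rV[R]_n -> R -> R) (q : option nat) (r : R)
    (Lam_open : open Lam)
    (I_open : open I) (I_interval : is_interval I) (I_0 : I 0)
    (q_neq0 : q <> Some 0%N)
    (psi_Cq : Cq q (Lam `*` I) (fun p => psi p.1 p.2))
    (psi_gt0 : forall lam, Lam lam -> 0 < psi lam 0)
    (r_neqN1 : r <> -1) :
  (* the integral defining F makes sense exactly when r > -1 *)
  (forall lam t, Lam lam -> I t -> t <> 0 ->
     (converges r (psi lam) t <-> -1 < r)) /\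
  (-1 < r ->
     let F := fun lam t => root_integral r (psi lam) t in
     let U := regular_dom r Lam I psi in
     [/\ open U,
         Cq q U (fun p => F p.1 p.2) &
         forall lam, Lam lam -> derivable (F lam) 0 1 /\ 0 < ((F lam)^`())%classic 0]).
Proof.
have cphi p := @Cq_continuous _ _ _ _ _ p psi_Cq.
split=> [lam t Ll It /eqP t0|r1 F U]; first exact: (converges_iff r I_interval I_0 cphi psi_gt0).
split; first exact: regular_dom_open.
(* The domain does not depend on k, so the finite orders together give order infinity. *)
- have CkF k := @Ck_root_integral _ _ _ _ _ r Lam_open I_open I_interval I_0 cphi psi_gt0 r1 k.
  by case: q psi_Cq {q_neq0 cphi CkF} (CkF) => [k|] Cpsi CkF; [exact: CkF|move=> k; exact: CkF].
- move=> lam Ll.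
  have [dF FE] := root_integral_is_derive0 Lam_open I_open I_interval I_0 cphi psi_gt0 r1 Ll.
  split; first exact: dF.
  by rewrite derive1E FE powR_gt0// normr_gt0 gt_eqF// (dilation_integral_gt0 psi_gt0).
Qed.
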